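(* Let $\sigma:\mathbb{Z}^+\to\mathcal{P}=\{1,\dots,\rho\}$ be a piecewise constant switching signal, and let $\mathcal{G}_{\sigma(k)}$, $k\in\mathbb{Z}^+$, be the corresponding undirected switching matrix-weighted graphs on $\{1,\dots,n\}$ with symmetric weights $\mathbf{A}_{ij}(k)=\mathbf{A}_{ji}(k)\ge 0$ in $\mathbb{R}^{d\times d}$ ($d\ge 2$) and matrix-weighted Laplacians $\mathbf{L}_{\sigma(k)}$. Suppose the joint connectedness assumption holds: there exists a subsequence $\{k_t:t\in\mathbb{Z}^+\}$ such that $\lim_{t\to\infty}k_t=\infty$, $k_{t+1}-k_t$ is uniformly bounded for all $t\ge 0$, and for each $t$ the union graph $\bigcup_{k=k_t}^{k_{t+1}-1}\mathcal{G}_{\sigma(k)}$ contains a positive spanning tree. Let $\mu=\max_{\sigma(k)}\|\mathbf{L}_{\sigma(k)}\|$ and suppose $0<\alpha<1/\mu$. Then, for every initial vector $\mathbf{x}(0)\in\mathbb{R}^{dn}$, the sequence $\{\mathbf{x}(k)\}$ generated by $$\mathbf{x}(k+1)=\mathbf{x}(k)-\alpha\mathbf{L}_{\sigma(k)}\mathbf{x}(k),\qquad k\in\mathbb{Z}^+,$$ asymptotically converges to the average consensus $\mathbf{x}^*=\mathbf{1}_n\otimes\bar{\mathbf{x}}$ as $k\to\infty$, where $\bar{\mathbf{x}}=\frac1n(\mathbf{1}_n^\top\otimes\mathbf{I}_d)\mathbf{x}(0)$.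
   Context: $\mathbb{Z}^+$ denotes the nonnegative integers. A switching signal $\sigma$ is piecewise constant if there is a subsequence $k_l$ of $\mathbb{Z}^+$ such that $\sigma(k)$ is constant for $k_l\le k<k_{l+1}$. For each value of $\sigma(k)$ in the finite set $\mathcal{P}$, $\mathcal{G}_{\sigma(k)}=(\mathcal{V},\mathcal{E}_{\sigma(k)},\mathcal{A}_{\sigma(k)})$ is a graph on $\mathcal{V}=\{1,\dots,n\}$ whose edges $(i,j)$, $i\neq j$, carry symmetric positive semidefinite matrix weights $\mathbf{A}_{ij}(k)=\mathbf{A}_{ji}(k)\in\mathbb{R}^{d\times d}$ (determined by $\sigma(k)$), with $\mathbf{A}_{ij}(k)=\mathbf{0}$ when $(i,j)\notin\mathcal{E}_{\sigma(k)}$; it is undirected but need not be connected. Its matrix-weighted Laplacian $\mathbf{L}_{\sigma(k)}\in\mathbb{R}^{dn\times dn}$ has diagonal blocks $\sum_{j\ne i}\mathbf{A}_{ij}(k)$ and off-diagonal blocks $-\mathbf{A}_{ij}(k)$. The union $\bigcup_{k=\gamma}^{\eta}\mathcal{G}_{\sigma(k)}$ is the matrix-weighted graph on $\mathcal{V}$ with edge set $\bigcup_{k=\gamma}^{\eta}\mathcal{E}_{\sigma(k)}$ and weights $\mathbf{A}_{ij}(\gamma:\eta)=\sum_{k=\gamma}^{\eta}\mathbf{A}_{ij}(k)$. A positive spanning tree of a matrix-weighted graph is a spanning tree all of whose edges have positive definite weights. $\|\cdot\|$ is the Euclidean norm on vectors and the induced (spectral) norm on matrices; $\mathbf{1}_n$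 is the all-ones vector. The state $\mathbf{x}(k)=[\mathbf{x}_1^\top(k),\dots,\mathbf{x}_n^\top(k)]^\top$ stacks $\mathbf{x}_i(k)\in\mathbb{R}^d$; the iteration is equivalent to $\mathbf{x}_i(k+1)=\mathbf{x}_i(k)-\alpha\sum_{j=1}^n\mathbf{A}_{ij}(k)(\mathbf{x}_i(k)-\mathbf{x}_j(k))$. *)

(* Defs.v *)
From HB Require Import structures.
From mathcomp Require Import all_boot all_order all_algebra.
From mathcomp Require Import mxtens.
From mathcomp Require Import all_classical all_reals all_analysis.

Set Implicit Arguments.
Unset Strict Implicit.
Unset Printing Implicit Defensive.

Import Order.TTheory GRing.Theory Num.Theory.
Import numFieldNormedType.Exports.

Local Open Scope classical_set_scope.
Local Open Scope ring_scope.

Definition psdmx (R : realType) (d : nat) (A : 'M[R]_d) : Prop :=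
  A^T = A /\ forall v : 'cV[R]_d, 0 <= (v^T *m A *m v) 0 0.

Definition pdmx (R : realType) (d : nat) (A : 'M[R]_d) : Prop :=
  A^T = A /\ forall v : 'cV[R]_d, v != 0 -> 0 < (v^T *m A *m v) 0 0.

(* The library norm on 'M[R]_(m, n) is the entrywise maximum, so the Euclidean
   norm and the operator norm it induces are defined here. The unit ball, rather
   than the unit sphere, keeps the set nonempty when n = 0. *)
Definition enorm (R : realType) (n : nat) (v : 'cV[R]_n) : R :=
  Num.sqrt (\sum_(i < n) v i 0 ^+ 2).

Definition spectral_norm (R : realType) (m n : nat) (A : 'M[R]_(m, n)) : R :=
  sup [set enorm (A *m v) | v in [set v : 'cV[R]_n | enorm v <= 1]].

(* Undirected graph on 'I_n with d x d matrix weights. An edge may carry a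
   weight that is only positive semidefinite, even zero. *)
Record mwgraph (R : realType) (n d : nat) := MWGraph {
  mw_edge : rel 'I_n;
  mw_weight : 'I_n -> 'I_n -> 'M[R]_d;
  mw_edge_sym : symmetric mw_edge;
  mw_edge_irr : irreflexive mw_edge;
  mw_weight_sym : forall i j, mw_weight i j = mw_weight j i;
  mw_weight_psd : forall i j, psdmx (mw_weight i j);
  mw_weight_eq0 : forall i j, ~~ mw_edge i j -> mw_weight i j = 0
}.

Definition mwL_block (R : realType) (n d : nat) (G : mwgraph R n d)
    (i j : 'I_n) : 'M[R]_d :=
  if i == j then \sum_(l < n | l != i) mw_weight G i l else - mw_weight G i j.

(* Index i * d + a of 'I_(n * d) is coordinate a of block i, the layout that
   the Kronecker product *t of mxtens also uses. *)
Definition mwLaplacian (R : realType) (n d : nat) (G : mwgraph R n d) :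
    'M[R]_(n * d) :=
  \matrix_(p, q) mwL_block G (mxtens_unindex p).1 (mxtens_unindex q).1
                   (mxtens_unindex p).2 (mxtens_unindex q).2.

Section Union.
Variables (R : realType) (n d : nat) (G : nat -> mwgraph R n d).
Variables (gamma eta : nat).

Definition mwU_edge : rel 'I_n :=
  fun i j => has (fun k => mw_edge (G k) i j) (index_iota gamma eta.+1).

Definition mwU_weight (i j : 'I_n) : 'M[R]_d :=
  \sum_(gamma <= k < eta.+1) mw_weight (G k) i j.

Lemma mwU_edge_sym : symmetric mwU_edge.
Proof. by move=> i j; apply: eq_has => k; rewrite mw_edge_sym. Qed.

Lemma mwU_edge_irr : irreflexive mwU_edge.
Proof. by move=> i; apply/hasP => -[k _]; rewrite mw_edge_irr. Qed.

Lemma mwU_weight_sym i j : mwU_weight i j = mwU_weight j i.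
Proof. by apply: eq_bigr => k _; rewrite mw_weight_sym. Qed.

Lemma mwU_weight_psd i j : psdmx (mwU_weight i j).
Proof.
split.
  rewrite /mwU_weight raddf_sum; apply: eq_bigr => k _.
  by have [] := mw_weight_psd (G k) i j.
move=> v; rewrite /mwU_weight mulmx_sumr mulmx_suml summxE.
by apply: sumr_ge0 => k _; have [_] := mw_weight_psd (G k) i j; apply.
Qed.

Lemma mwU_weight_eq0 i j : ~~ mwU_edge i j -> mwU_weight i j = 0.
Proof.
move=> /hasPn nE; rewrite /mwU_weight big_seq big1 // => k kI.
by apply: mw_weight_eq0; apply: nE.
Qed.

Definition mwUnion : mwgraph R n d :=
  MWGraph mwU_edge_sym mwU_edge_irr mwU_weight_sym mwU_weight_psd
    mwU_weight_eq0.

End Union.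

(* A symmetric relation always has the two-vertex cycles [:: i; j], so
   acyclicity only excludes simple cycles through at least three vertices. *)
Definition is_tree (n : nat) (T : rel 'I_n) : Prop :=
  [/\ symmetric T, irreflexive T, (forall i j, connect T i j)
    & forall c : seq 'I_n, ucycle T c -> (size c <= 2)%N].

Definition positive_spanning_tree (R : realType) (n d : nat)
    (G : mwgraph R n d) (T : rel 'I_n) : Prop :=
  [/\ is_tree T, subrel T (mw_edge G)
    & forall i j, T i j -> pdmx (mw_weight G i j)].

Definition is_subsequence (k : nat -> nat) : Prop :=
  {homo k : s t / (s < t)%N}.

Definition piecewise_constant (T : Type) (sigma : nat -> T) : Prop :=
  exists2 kl : nat -> nat, is_subsequence kl &
    forall l k, (kl l <= k < kl l.+1)%N -> sigma k = sigma (kl l).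

Definition jointly_connected (R : realType) (n d rho : nat)
    (G : 'I_rho -> mwgraph R n d) (sigma : nat -> 'I_rho) : Prop :=
  exists kt : nat -> nat,
    [/\ is_subsequence kt,
        kt t @[t --> \oo] --> \oo,
        (exists B : nat, forall t, (kt t.+1 - kt t <= B)%N)
      & forall t, exists T : rel 'I_n,
          positive_spanning_tree
            (mwUnion (fun k => G (sigma k)) (kt t) (kt t.+1).-1) T].

(* Only the modes that sigma takes contribute; the norms are nonnegative, so the
   base value 0 does not affect the maximum. *)
Definition max_laplacian_norm (R : realType) (n d rho : nat)
    (G : 'I_rho -> mwgraph R n d) (sigma : nat -> 'I_rho) : R :=
  \big[Num.max/0]_(p < rho | `[< exists k, sigma k = p >])
     spectral_norm (mwLaplacian (G p)).

(* The cast identifies 1 * d with d. *)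
Definition block_average (R : realType) (n d : nat) (x : 'cV[R]_(n * d)) :
    'cV[R]_d :=
  n%:R^-1 *: (castmx (mul1n d, erefl (n * d)%N)
                ((const_mx 1 : 'cV[R]_n)^T *t (1%:M : 'M[R]_d)) *m x).

Definition average_consensus (R : realType) (n d : nat) (x : 'cV[R]_(n * d)) :
    'cV[R]_(n * d) :=
  (const_mx 1 : 'cV[R]_n) *t block_average x.

(* Main.v *)
Require Import Defs.
From mathcomp Require Import all_boot all_order all_algebra.
From mathcomp Require Import all_classical all_reals all_analysis.
From mathcomp Require Import mxtens ring lra.
Import Order.TTheory GRing.Theory Num.Theory.
Import numFieldNormedType.Exports.
Local Open Scope classical_set_scope.
Local Open Scope ring_scope.

(** Let [z k = x k - x*] be the distance to consensus. The iteration preserves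
    the sum of the blocks and every Laplacian kills consensus vectors, so [z]
    follows the same recursion, and its blocks always sum to zero.

    Each step is a gradient step for the quadratic form [q_k] of the current
    Laplacian [L]. For a positive semidefinite [L], the inequality
    [|L v|^2 <= |L| (v^T L v)] turns [alpha |L| < 1] into
    [alpha |L v|^2 <= q_k v] ([laplacian_step_bound]), so that the squared norm
    [V k = |z k|^2] drops by at least [alpha q_k (z k)] ([descent_energy]). One
    step alone may not decrease [V], since the current graph may be disconnected.

    Over a window [k_t, k_(t+1)) of bounded length, the drop of [V] controls both
    every [q_k (z k)] and the displacement of [z] from [z (k_t)]; hence it
    controls every mode of the window evaluated at the single vector [z (k_t)]
    ([switched_window_energy]). A vector with zero block sum that is in the
    kernel of all the modes of a window is zero: along the edges of the positive
    spanning tree its blocks agree, so it is a consensus vector with zero sum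
    ([union_kernel]). Thus the sum of the modes of the window is coercive on zero
    sum vectors; as there are finitely many sets of modes, one constant serves
    all windows ([coercive_uniform]). Together,
    [V k_t <= K (V k_t - V k_(t+1))] with [K] independent of [t]. A nonincreasing
    nonnegative [V] has a limit [l], and then [l <= K (l - l) = 0]
    ([cvg0_of_window_drop]). *)

(** * Quadratic forms *)

Definition bform {R : realType} {N : nat} (A : 'M[R]_N) (u v : 'cV[R]_N) : R :=
  (u^T *m A *m v) 0 0.

(** The case [A = 1] is the squared Euclidean norm, so that the facts on positive
    semidefinite forms apply to the norm too. *)
Definition sqnorm {R : realType} {N : nat} (v : 'cV[R]_N) : R := bform 1%:M v v.

Section BilinearForms.
Context {R : realType} {N : nat}.
Implicit Types (A B : 'M[R]_N) (u v w : 'cV[R]_N).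

Lemma bformDl A u v w : bform A (u + v) w = bform A u w + bform A v w.
Proof. by rewrite /bform linearD !mulmxDl mxE. Qed.

Lemma bformDr A u v w : bform A w (u + v) = bform A w u + bform A w v.
Proof. by rewrite /bform mulmxDr mxE. Qed.

Lemma bformZl A a u v : bform A (a *: u) v = a * bform A u v.
Proof. by rewrite /bform linearZ -!scalemxAl mxE. Qed.

Lemma bformZr A a u v : bform A u (a *: v) = a * bform A u v.
Proof. by rewrite /bform -!scalemxAr mxE. Qed.

Lemma bformNl A u v : bform A (- u) v = - bform A u v.
Proof. by rewrite -scaleN1r bformZl mulN1r. Qed.

Lemma bformNr A u v : bform A u (- v) = - bform A u v.
Proof. by rewrite -scaleN1r bformZr mulN1r. Qed.

Lemma bformC A u v : A^T = A -> bform A u v = bform A v u.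
Proof.
move=> As; have -> : bform A v u = (v^T *m A *m u)^T 0 0 by rewrite [RHS]mxE.
by rewrite !trmx_mul trmxK As mulmxA.
Qed.

Lemma bform_mulr A u v : bform A u v = bform 1%:M u (A *m v).
Proof. by rewrite /bform mulmx1 mulmxA. Qed.

Lemma bform_sum (I : finType) (P : pred I) (F : I -> 'M[R]_N) u v :
  bform (\sum_(p | P p) F p) u v = \sum_(p | P p) bform (F p) u v.
Proof. by rewrite /bform mulmx_sumr mulmx_suml summxE. Qed.

Lemma psdmx1 : psdmx (1%:M : 'M[R]_N).
Proof.
split=> [|v]; first exact: trmx1.
by rewrite mulmx1 mxE; apply: sumr_ge0 => i _; rewrite mxE -expr2 sqr_ge0.
Qed.

Lemma psdmx_sum (I : finType) (P : pred I) (F : I -> 'M[R]_N) :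
  (forall p, P p -> psdmx (F p)) -> psdmx (\sum_(p | P p) F p).
Proof.
move=> Fpsd; split.
  by rewrite raddf_sum; apply: eq_bigr => p Pp; case: (Fpsd p Pp).
move=> v; rewrite -/(bform _ v v) bform_sum; apply: sumr_ge0 => p Pp.
by case: (Fpsd p Pp) => _; apply.
Qed.

Lemma bform_ge0 A v : psdmx A -> 0 <= bform A v v.
Proof. by move=> [_]; apply. Qed.

Lemma bform_sqrD A u v a : A^T = A ->
  bform A (u + a *: v) (u + a *: v)
  = bform A u u + 2 * a * bform A u v + a ^+ 2 * bform A v v.
Proof.
move=> As; rewrite !(bformDl, bformDr, bformZl, bformZr) (bformC A v u As).
by ring.
Qed.

(** The gap is the form at [u - 2 v]. This replaces the triangle inequality. *)
Lemma bform_parallelogram A u v : psdmx A ->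
  bform A u u <= 2 * bform A v v + 2 * bform A (u - v) (u - v).
Proof.
move=> Apsd; have [As _] := Apsd.
have := bform_ge0 A (u + (- 2) *: v) Apsd.
by rewrite -[u - v]/(u + - v) -(scaleN1r v) !bform_sqrD //; nra.
Qed.

(** The form is nonnegative at every [u + a v]; take the [a] that minimises it. *)
Lemma bform_cauchy_schwarz A u v : psdmx A ->
  bform A u v ^+ 2 <= bform A u u * bform A v v.
Proof.
move=> Apsd; have [As _] := Apsd.
have nonneg a : 0 <= bform A u u + 2 * a * bform A u v + a ^+ 2 * bform A v v.
  by rewrite -bform_sqrD //; apply: bform_ge0.
have := bform_ge0 A v Apsd; rewrite le_eqVlt => /predU1P[v0|v_gt0].
  have [->|uv0] := eqVneq (bform A u v) 0; first by rewrite expr0n -v0 mulr0.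
  (* The form is affine in [a], and this [a] gives it the value -1. *)
  have := nonneg (- (bform A u u + 1) / (2 * bform A u v)).
  rewrite -v0 mulr0 addr0.
  have -> : bform A u u + 2 * (- (bform A u u + 1) / (2 * bform A u v))
    * bform A u v = -1 by field.
  by rewrite oppr_ge0 ler10.
have := nonneg (- bform A u v / bform A v v).
have -> : bform A u u + 2 * (- bform A u v / bform A v v) * bform A u v
  + (- bform A u v / bform A v v) ^+ 2 * bform A v v
  = bform A u u - bform A u v ^+ 2 / bform A v v by field; rewrite gt_eqF.
by rewrite subr_ge0 ler_pdivrMr.
Qed.

Lemma sqnorm_ge0 v : 0 <= sqnorm v.
Proof. exact/bform_ge0/psdmx1. Qed.

Lemma sqnormE v : sqnorm v = \sum_i v i 0 ^+ 2.
Proof.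
by rewrite /sqnorm /bform mulmx1 mxE; apply: eq_bigr => i _; rewrite mxE expr2.
Qed.

Lemma sqnorm_eq0 v : sqnorm v = 0 -> v = 0.
Proof.
rewrite sqnormE => /eqP; rewrite psumr_eq0; last by move=> i _; exact: sqr_ge0.
move=> /allP v0; apply/colP => i; rewrite mxE.
by have := v0 i (mem_index_enum _); rewrite sqrf_eq0 => /eqP.
Qed.

Lemma sqnormZ a v : sqnorm (a *: v) = a ^+ 2 * sqnorm v.
Proof. by rewrite /sqnorm bformZl bformZr mulrA. Qed.

Lemma enormE v : enorm v = Num.sqrt (sqnorm v).
Proof. by rewrite sqnormE. Qed.

Lemma sqr_enorm v : enorm v ^+ 2 = sqnorm v.
Proof. by rewrite enormE sqr_sqrtr ?sqnorm_ge0. Qed.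

Lemma enorm_ge0 v : 0 <= enorm v.
Proof. exact: sqrtr_ge0. Qed.

Lemma enorm0 : enorm (0 : 'cV[R]_N) = 0.
Proof.
by rewrite enormE sqnormE big1 ?sqrtr0 // => i _; rewrite mxE expr0n.
Qed.

Lemma enormZ a v : 0 <= a -> enorm (a *: v) = a * enorm v.
Proof.
by move=> a0; rewrite !enormE sqnormZ sqrtrM ?sqr_ge0 // sqrtr_sqr ger0_norm.
Qed.

End BilinearForms.

(** * Operator bounds and coercivity *)

Section OperatorBounds.
Context {R : realType}.

(** Cauchy-Schwarz on each row of [A]. It makes the supremum in [spectral_norm]
    finite. *)
Lemma sqnorm_mulmx_bound {m n} (A : 'M[R]_(m, n)) :
  exists2 C, 0 <= C & forall v, sqnorm (A *m v) <= C * sqnorm v.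
Proof.
exists (\sum_i sqnorm (row i A)^T).
  by apply: sumr_ge0 => i _; exact: sqnorm_ge0.
move=> v; rewrite sqnormE mulr_suml; apply: ler_sum => i _.
have -> : (A *m v) i 0 = bform 1%:M (row i A)^T v.
  by rewrite /bform mulmx1 trmxK -row_mul [RHS]mxE.
exact/bform_cauchy_schwarz/psdmx1.
Qed.

Lemma le_spectral_norm {m n} (A : 'M[R]_(m, n)) v :
  enorm v <= 1 -> enorm (A *m v) <= spectral_norm A.
Proof.
move=> v1; apply: ub_le_sup; last by exists v.
have [C C0 AC] := sqnorm_mulmx_bound A.
exists (Num.sqrt C) => _ [w w1 <-]; rewrite enormE ler_wsqrtr //.
rewrite (le_trans (AC w)) // ler_piMr // -sqr_enorm.
by rewrite expr_le1 ?enorm_ge0.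
Qed.

Lemma enorm_mulmx_le {m n} (A : 'M[R]_(m, n)) v :
  enorm (A *m v) <= spectral_norm A * enorm v.
Proof.
have [v0|v_neq0] := eqVneq (enorm v) 0.
  have -> : v = 0 by apply: sqnorm_eq0; rewrite -sqr_enorm v0 expr0n.
  by rewrite mulmx0 !enorm0 mulr0.
have v_gt0 : 0 < enorm v by rewrite lt_def v_neq0 enorm_ge0.
rewrite -ler_pdivrMr // mulrC -enormZ ?invr_ge0 ?enorm_ge0 // scalemxAr.
by apply: le_spectral_norm; rewrite enormZ ?invr_ge0 ?enorm_ge0 // mulVf.
Qed.

(** With [w = A v], Cauchy-Schwarz for the form [A] gives
    [|w|^4 = (w^T A v)^2 <= (w^T A w) (v^T A v) <= m |w|^2 (v^T A v)]. *)
Lemma sqnorm_psd_mulmx_le {N} (A : 'M[R]_N) (m : R) (v : 'cV[R]_N) :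
  psdmx A -> 0 <= m -> (forall w, sqnorm (A *m w) <= m ^+ 2 * sqnorm w) ->
  sqnorm (A *m v) <= m * bform A v v.
Proof.
move=> Apsd m0 Am; set w := A *m v.
have qw : bform A w w <= m * sqnorm w.
  have : bform A w w ^+ 2 <= (m * sqnorm w) ^+ 2.
    rewrite bform_mulr (le_trans (bform_cauchy_schwarz _ _ _ psdmx1)) //.
    rewrite exprMn mulrC expr2 mulrA.
    by apply: ler_wpM2r (Am w); exact: sqnorm_ge0.
  by rewrite ler_sqr ?nnegrE ?bform_ge0 ?mulr_ge0 ?sqnorm_ge0.
have := bform_cauchy_schwarz _ w v Apsd.
rewrite [bform A w v]bform_mulr -/w -/(sqnorm w) => ww.
have := sqnorm_ge0 w; rewrite le_eqVlt => /predU1P[<-|w_gt0].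
  by rewrite mulr_ge0 ?bform_ge0.
rewrite -(ler_pM2l w_gt0) -expr2 (le_trans ww) //.
by rewrite mulrA [sqnorm w * m]mulrC ler_wpM2r ?bform_ge0.
Qed.

Lemma psdmx_ker {N} (A : 'M[R]_N) v : psdmx A -> bform A v v = 0 -> A *m v = 0.
Proof.
move=> Apsd q0; apply: sqnorm_eq0; apply/eqP; rewrite -sqrf_eq0.
rewrite eq_le sqr_ge0 andbT {1}/sqnorm -bform_mulr.
by rewrite (le_trans (bform_cauchy_schwarz _ _ _ Apsd)) // q0 mulr0.
Qed.

(** Injectivity of the pair [(J, A)] gives a left inverse [P] of [col_mx J A], and
    [y = P (J y, A y)] bounds [y] by [A y] when [J y = 0]; [|A y|^2] is in turn
    bounded by the form. *)
Lemma psdmx_coercive {N r} (A : 'M[R]_N) (J : 'M[R]_(r, N)) : psdmx A ->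
  (forall y : 'cV[R]_N, J *m y = 0 -> A *m y = 0 -> y = 0) ->
  exists2 C, 0 <= C & forall y, J *m y = 0 -> sqnorm y <= C * bform A y y.
Proof.
move=> Apsd inj.
have /row_fullP [P] : row_full (col_mx J A).
  rewrite /row_full -mxrank_tr -/(row_free _); apply: inj_row_free => v.
  move=> vJA; have : col_mx J A *m v^T = 0.
    by apply: trmx_inj; rewrite trmx_mul trmxK vJA trmx0.
  rewrite mul_col_mx -[0]vsubmxK => /eq_col_mx [Jv Av].
  by rewrite -[v]trmxK (inj v^T) ?trmx0 ?Jv ?Av ?linear0.
move=> PJA.
have [C C0 PC] := sqnorm_mulmx_bound (rsubmx P).
have [D D0 AD] := sqnorm_mulmx_bound A.
exists (C * (D + 1)); first by rewrite mulr_ge0 // addr_ge0.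
move=> y Jy.
have -> : sqnorm y = sqnorm (rsubmx P *m (A *m y)).
  congr sqnorm; rewrite -[LHS]mul1mx -PJA -{1}(hsubmxK P) -mulmxA mul_col_mx.
  by rewrite mul_row_col Jy mulmx0 add0r.
rewrite (le_trans (PC _)) // -mulrA ler_wpM2l //.
(* [D] bounds the square of the operator norm, and [D <= (D + 1)^2]. *)
apply: sqnorm_psd_mulmx_le => //; first exact: addr_ge0.
move=> w; rewrite (le_trans (AD w)) // ler_wpM2r ?sqnorm_ge0 //.
by nra.
Qed.

End OperatorBounds.

(** * Convergence to zero *)

Section Limits.
Context {R : realType}.

(** The bound says that [V] contracts along [kt] by a fixed factor; passing to the
    limit in it, both [V (kt t)] and [V (kt t.+1)] tend to [limn V]. *)
Lemma cvg0_of_window_drop (V : nat -> R) (kt : nat -> nat) (K : R) :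
  (forall k, 0 <= V k) -> (forall k, V k.+1 <= V k) ->
  kt t @[t --> \oo] --> \oo ->
  (forall t, V (kt t) <= K * (V (kt t) - V (kt t.+1))) ->
  V k @[k --> \oo] --> 0.
Proof.
move=> V0 Vdec kt_oo drop.
have Vcvg : cvgn V.
  apply: nonincreasing_is_cvgn; first exact/nonincreasing_seqP.
  by exists 0 => _ [k _ <-].
set l := limn V in Vcvg *.
have Vkt : V (kt t) @[t --> \oo] --> l by exact: cvg_comp kt_oo Vcvg.
have VktS : V (kt t.+1) @[t --> \oo] --> l.
  by rewrite (cvg_shiftS (fun t => V (kt t))).
have l0 : 0 <= l by apply: limr_ge => //; apply: nearW => k; exact: V0.
suff l_le0 : l <= 0 by have <- : l = 0 by apply/le_anti; rewrite l0 l_le0.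
have RHS_cvg : K * (V (kt t) - V (kt t.+1)) @[t --> \oo] --> K * (l - l).
  exact: cvgMl_tmp (cvgB Vkt VktS).
have : limn (fun t => V (kt t)) <= limn (fun t => K * (V (kt t) - V (kt t.+1))).
  by apply: ler_lim; [exact: cvgP Vkt | exact: cvgP RHS_cvg | exact: nearW].
by rewrite (cvg_lim _ Vkt) // (cvg_lim _ RHS_cvg) // subrr mulr0.
Qed.

(** The topology on matrices comes from the maximum norm, which the Euclidean norm
    dominates. *)
Lemma cvg0_of_sqnorm {N} (z : nat -> 'cV[R]_N) :
  sqnorm (z k) @[k --> \oo] --> 0 -> z k @[k --> \oo] --> (0 : 'cV[R]_N).
Proof.
move=> zsq; apply: norm_cvg0.
have sq : Num.sqrt (sqnorm (z k)) @[k --> \oo] --> 0.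
  rewrite -[X in _ --> X]sqrtr0.
  by apply: continuous_cvg zsq; exact: sqrt_continuous.
apply: (squeeze_cvgr _ (cvg_cst 0) sq); apply: nearW => k.
rewrite normr_ge0 /= {1}/Num.norm /= mx_normrE.
apply: bigmax_le => [|[i j] _ /=]; first exact: sqrtr_ge0.
rewrite ord1 -sqrtr_sqr ler_wsqrtr // sqnormE (bigD1 i) //= lerDl.
by apply: sumr_ge0 => l _; exact: sqr_ge0.
Qed.

End Limits.

(** * One gradient step, and switched gradient steps *)

Section Descent.
Context {R : realType} {N : nat} {A : 'M[R]_N} {alpha : R}.
Hypothesis alpha_gt0 : 0 < alpha.
Hypothesis Aalpha : forall v, alpha * sqnorm (A *m v) <= bform A v v.

(** Expanding the square, the drop is [2 alpha q - alpha^2 |A v|^2], and the step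
    size hypothesis lets half of the first term absorb the second. *)
Lemma descent_energy v :
  alpha * bform A v v <= sqnorm v - sqnorm (v - alpha *: (A *m v)).
Proof.
rewrite -scaleNr {2}/sqnorm bform_sqrD ?trmx1 // -bform_mulr -/(sqnorm v).
rewrite -/(sqnorm (A *m v)); move: alpha_gt0 (Aalpha v); nra.
Qed.

Lemma descent_increment v :
  sqnorm (v - alpha *: (A *m v) - v)
    <= sqnorm v - sqnorm (v - alpha *: (A *m v)).
Proof.
apply: le_trans (descent_energy v).
rewrite addrAC subrr add0r -scaleNr sqnormZ sqrrN expr2 -mulrA.
by rewrite ler_pM2l.
Qed.

(** The new vector has nonnegative norm, so the energy lost is at most
    [sqnorm v]. *)
Lemma descent_bform_le v : alpha * bform A v v <= sqnorm v.
Proof.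
by rewrite (le_trans (descent_energy v)) // lerBlDr lerDl sqnorm_ge0.
Qed.

End Descent.

Section SwitchedDescent.
Context {R : realType} {N r : nat} {I : finType}.
Variables (A : I -> 'M[R]_N) (J : 'M[R]_(r, N)) (alpha : R) (sigma : nat -> I).
Variable z : nat -> 'cV[R]_N.
Hypotheses (Apsd : forall p, psdmx (A p)) (alpha_gt0 : 0 < alpha).
Hypothesis Aalpha :
  forall k v, alpha * sqnorm (A (sigma k) *m v) <= bform (A (sigma k)) v v.
Hypothesis zS : forall k, z k.+1 = z k - alpha *: (A (sigma k) *m z k).

Let V k := sqnorm (z k).

Lemma switched_energy k :
  alpha * bform (A (sigma k)) (z k) (z k) <= V k - V k.+1.
Proof. by rewrite /V zS; exact: descent_energy. Qed.

Lemma switched_decr k : V k.+1 <= V k.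
Proof.
rewrite -subr_ge0 (le_trans _ (switched_energy k)) //.
by rewrite mulr_ge0 ?bform_ge0 // ltW.
Qed.

Lemma switched_mono s k : (s <= k)%N -> V k <= V s.
Proof.
move=> /subnKC <-; elim: (k - s)%N => [|m IHm]; first by rewrite addn0.
by rewrite addnS (le_trans (switched_decr _)).
Qed.

(** Each step moves [z] by at most the square root of the drop of [V]. The factor
    [2 ^+ m] comes from applying the parallelogram bound once per step; any constant
    that depends on [m] alone would do, since windows have bounded length. *)
Lemma switched_drift s m :
  sqnorm (z (s + m)%N - z s) <= 2 ^+ m * (V s - V (s + m)%N).
Proof.
elim: m => [|m IHm].
  by rewrite addn0 !subrr mulr0 sqnormE big1 // => i _; rewrite mxE expr0n.
have step : sqnorm (z (s + m.+1)%N - z (s + m)%N)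
    <= V (s + m)%N - V (s + m.+1)%N.
  by rewrite addnS /V zS; exact: descent_increment.
have drop : 0 <= V (s + m)%N - V (s + m.+1)%N.
  by rewrite subr_ge0 switched_mono // leq_add2l.
have e1 : (1 : R) <= 2 ^+ m by rewrite exprn_ege1 // ler1n.
have := bform_parallelogram 1%:M (z (s + m.+1)%N - z s)
  (z (s + m.+1)%N - z (s + m)%N) psdmx1.
have -> : z (s + m.+1)%N - z s - (z (s + m.+1)%N - z (s + m)%N)
  = z (s + m)%N - z s by rewrite opprB addrC addrA subrK.
rewrite -/(sqnorm _) -/(sqnorm _) -/(sqnorm _) exprS; nra.
Qed.

(** The mode used at time [k] is small at [z k] by the energy drop, and [z s] is
    close to [z k] by the drift bound. Evaluating all the modes of the window at
    the same vector [z s] is what allows them to be added up. *)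
Lemma switched_window_energy s k e B : (s <= k < e)%N -> (e - s <= B)%N ->
  alpha * bform (A (sigma k)) (z s) (z s) <= (2 + 2 * 2 ^+ B) * (V s - V e).
Proof.
move=> /andP[sk ke] esB.
have Vsk := switched_mono _ _ sk; have Vke := switched_mono _ _ ke.
have Vkk := switched_decr k.
have now := switched_energy k.
have drift : sqnorm (z s - z k) <= 2 ^+ B * (V s - V e).
  have := switched_drift s (k - s); rewrite subnKC //.
  rewrite -{1}(opprB (z s)) -scaleN1r sqnormZ sqrrN expr1n mul1r.
  move=> /le_trans -> //.
  apply: ler_pM; rewrite ?exprn_ge0 ?subr_ge0 ?lerD2l ?lerN2 //.
    apply: ler_weXn2l; first by rewrite ler1n.
    by rewrite (leq_trans _ esB) // leq_sub2r // ltnW.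
  exact: le_trans Vke Vkk.
have := descent_bform_le alpha_gt0 (Aalpha k) (z s - z k).
have := bform_parallelogram _ (z s) (z k) (Apsd (sigma k)).
rewrite -(ler_pM2l alpha_gt0) mulrDr !(mulrCA alpha) => par small.
apply: le_trans par _; rewrite [leRHS]mulrDl -[in leRHS]mulrA.
apply: lerD; rewrite ler_pM2l //.
  exact: le_trans now (lerB Vsk Vke).
exact: le_trans small drift.
Qed.

(** There are finitely many sets of modes; the sum of their coercivity constants
    serves all of them, with 0 for the sets that are not jointly injective. *)
Lemma coercive_uniform :
  exists2 C, 0 <= C & forall S : {set I},
    (forall y : 'cV[R]_N, J *m y = 0 -> (forall p, p \in S -> A p *m y = 0) ->
       y = 0) ->
    forall y, J *m y = 0 -> sqnorm y <= C * \sum_(p in S) bform (A p) y y.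
Proof.
have /choice [C CS] (S : {set I}) : exists C, 0 <= C /\
    ((forall y : 'cV[R]_N, J *m y = 0 -> (forall p, p \in S -> A p *m y = 0) ->
       y = 0) ->
    forall y, J *m y = 0 -> sqnorm y <= C * \sum_(p in S) bform (A p) y y).
  have [inj|] := pselect (forall y : 'cV[R]_N, J *m y = 0 ->
    (forall p, p \in S -> A p *m y = 0) -> y = 0); last by exists 0.
  have sum_psd : psdmx (\sum_(p in S) A p) by apply: psdmx_sum.
  have [|C C0 HC] := psdmx_coercive (\sum_(p in S) A p) J sum_psd.
    move=> y Jy Ay; apply: inj => // p pS; apply: psdmx_ker => //.
    have : \sum_(p in S) bform (A p) y y = 0.
      by rewrite -bform_sum bform_mulr Ay /bform mulmx0 mxE.
    by move/eqP; rewrite psumr_eq0 => [/allP/(_ p (mem_index_enum _))|q _];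
      [rewrite pS => /eqP | exact: bform_ge0].
  by exists C; split=> // _ y Jy; rewrite -bform_sum HC.
exists (\sum_S C S) => [|S inj y Jy].
  by apply: sumr_ge0 => S _; case: (CS S).
have [_ /(_ inj y Jy)/le_trans-> //] := CS S.
apply: ler_wpM2r; first by apply: sumr_ge0 => p _; exact: bform_ge0.
by rewrite (bigD1 S) //= lerDl; apply: sumr_ge0 => T _; case: (CS T).
Qed.

(** The number of windows is infinite, but each one matters only through the set
    [S] of modes that occur in it, so coercivity holds with a single constant. *)
Theorem switched_descent_cvg0 (kt : nat -> nat) (B : nat) :
  (forall k, J *m z k = 0) ->
  kt t @[t --> \oo] --> \oo ->
  (forall t, kt t < kt t.+1)%N ->
  (forall t, kt t.+1 - kt t <= B)%N ->
  (forall t (y : 'cV[R]_N), J *m y = 0 ->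
     (forall k, (kt t <= k < kt t.+1)%N -> A (sigma k) *m y = 0) -> y = 0) ->
  z k @[k --> \oo] --> (0 : 'cV[R]_N).
Proof.
move=> Jz kt_oo ktS ktB inj; apply: cvg0_of_sqnorm.
have [C C0 HC] := coercive_uniform.
pose D := (2 + 2 * 2 ^+ B : R).
apply: (@cvg0_of_window_drop _ V kt (C * (#|I|%:R * (alpha^-1 * D)))) => //.
- by move=> k; exact: sqnorm_ge0.
- exact: switched_decr.
move=> t; pose S : {set I} :=
  [set p | has (fun k => sigma k == p) (index_iota (kt t) (kt t.+1))]%SET.
have SP p :
    reflect (exists2 k, (kt t <= k < kt t.+1)%N & sigma k = p) (p \in S).
  rewrite inE; apply: (iffP hasP) => [[k]|[k]].
    by rewrite mem_index_iota => ? /eqP; exists k.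
  by move=> kI <-; exists k; rewrite ?mem_index_iota.
have injS (y : 'cV[R]_N) : J *m y = 0 ->
    (forall p, p \in S -> A p *m y = 0) -> y = 0.
  move=> Jy yS; apply: (inj t) => // k kI; apply: yS; apply/SP; by exists k.
rewrite (le_trans (HC S injS _ (Jz _))) // -mulrA ler_wpM2l //.
have drop : 0 <= alpha^-1 * D * (V (kt t) - V (kt t.+1)).
  apply: mulr_ge0; last by rewrite subr_ge0 switched_mono // ltnW.
  apply: mulr_ge0; first by rewrite invr_ge0 ltW.
  by rewrite addr_ge0 // mulr_ge0 // exprn_ge0.
apply: (@le_trans _ _ (\sum_(p in S) alpha^-1 * D * (V (kt t) - V (kt t.+1)))).
  apply: ler_sum => p /SP [k kI <-].
  by rewrite -mulrA ler_pdivlMl // switched_window_energy.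
rewrite sumr_const -[leLHS]mulr_natl -[leRHS]mulrA ler_wpM2r // ler_nat.
exact: max_card.
Qed.

End SwitchedDescent.
(** * Block vectors *)

Section Blocks.
Context {R : realType} {n d : nat}.
Implicit Types (x y : 'cV[R]_(n * d)) (i j : 'I_n).

Definition blk x i : 'cV[R]_d := \col_a x (mxtens_index (i, a)) 0.

(** Built from the same Kronecker product as [block_average], which is therefore
    [n^-1] times its action, by definition. *)
Definition block_sum_mx : 'M[R]_(d, n * d) :=
  castmx (mul1n d, erefl (n * d)%N)
    ((const_mx 1 : 'cV[R]_n)^T *t (1%:M : 'M[R]_d)).

Lemma blk_inj x y : (forall i, blk x i = blk y i) -> x = y.
Proof.
move=> xy; apply/colP => p; case: (mxtens_indexP p) => i a.
by have /colP/(_ a) := xy i; rewrite !mxE.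
Qed.

Lemma blk0 i : blk 0 i = 0.
Proof. by apply/colP => a; rewrite !mxE. Qed.

Lemma sum_mxtens (F : 'I_(n * d) -> R) :
  \sum_p F p = \sum_i \sum_a F (mxtens_index (i, a)).
Proof.
rewrite pair_bigA /= (reindex (@mxtens_index n d)) /=.
  by apply: eq_bigr => -[].
by exists (@mxtens_unindex n d) => ? _; rewrite ?mxtens_indexK ?mxtens_unindexK.
Qed.

Lemma bform_blk x y : bform 1%:M x y = \sum_i bform 1%:M (blk x i) (blk y i).
Proof.
rewrite /bform mulmx1 mxE sum_mxtens; apply: eq_bigr => i _.
by rewrite mulmx1 mxE; apply: eq_bigr => a _; rewrite !mxE.
Qed.

Lemma block_sum_mxE x : block_sum_mx *m x = \sum_i blk x i.
Proof.
have entry a i b : block_sum_mx a (mxtens_index (i, b)) = (a == b)%:R.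
  rewrite castmxE !mxE cast_ord_id mxtens_indexK /= mul1r.
  by congr (nat_of_bool (_ == b))%:R; apply: val_inj; rewrite /= modn_small.
apply/colP => a; rewrite mxE summxE sum_mxtens; apply: eq_bigr => i _.
rewrite (bigD1 a) //= big1 => [|b ba]; rewrite entry.
  by rewrite eqxx mul1r addr0 mxE.
by rewrite eq_sym (negPf ba) mul0r.
Qed.

Lemma blk_average_consensus x i :
  blk (average_consensus x) i = n%:R^-1 *: \sum_j blk x j.
Proof.
rewrite -block_sum_mxE; apply/colP => a.
by rewrite mxE [LHS]mxE mxE mul1r mxtens_indexK [X in block_average x _ X]ord1.
Qed.

End Blocks.

(** * Matrix-weighted Laplacians *)

Section Laplacian.
Context {R : realType} {n d : nat} (G : mwgraph R n d).
Implicit Types (x y : 'cV[R]_(n * d)) (i j : 'I_n).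

Lemma blk_laplacian x i :
  blk (mwLaplacian G *m x) i
  = \sum_j mw_weight G i j *m (blk x i - blk x j).
Proof.
transitivity (\sum_j mwL_block G i j *m blk x j).
  apply/colP => a; rewrite !mxE summxE sum_mxtens; apply: eq_bigr => j _.
  by rewrite mxE; apply: eq_bigr => b _; rewrite !mxE !mxtens_indexK.
rewrite (bigD1 i) //= [RHS](bigD1 i) //= subrr mulmx0 add0r.
rewrite {1}/mwL_block eqxx mulmx_suml -big_split /=; apply: eq_bigr => j ji.
by rewrite /mwL_block eq_sym (negPf ji) mulmxBr mulNmx.
Qed.

Lemma trmx_mwL_block i j : (mwL_block G i j)^T = mwL_block G j i.
Proof.
rewrite /mwL_block [j == i]eq_sym; case: eqVneq => [->|_].
  by rewrite raddf_sum; apply: eq_bigr => l _; case: (mw_weight_psd G j l).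
by rewrite linearN /= mw_weight_sym; case: (mw_weight_psd G j i) => ->.
Qed.

Lemma laplacian_sym : (mwLaplacian G)^T = mwLaplacian G.
Proof. by apply/matrixP => p q; rewrite !mxE -trmx_mwL_block mxE. Qed.

(** The factor 2 appears because every undirected edge is counted twice. *)
Lemma bform_laplacian x :
  2 * bform (mwLaplacian G) x x
  = \sum_i \sum_j
      bform (mw_weight G i j) (blk x i - blk x j) (blk x i - blk x j).
Proof.
have E : bform (mwLaplacian G) x x
    = \sum_i \sum_j bform (mw_weight G i j) (blk x i) (blk x i - blk x j).
  rewrite bform_mulr bform_blk; apply: eq_bigr => i _.
  rewrite blk_laplacian /bform mulmx_sumr summxE; apply: eq_bigr => j _.
  by rewrite mulmx1 mulmxA.
rewrite mulrDl mul1r {1}E exchange_big /= {}E -big_split; apply: eq_bigr => i _.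
rewrite -big_split; apply: eq_bigr => j _ /=; rewrite mw_weight_sym.
rewrite [in RHS]bformDl addrC; congr (_ + _).
by rewrite bformNl -(opprB (blk x j)) bformNr opprK.
Qed.

Lemma laplacian_psd : psdmx (mwLaplacian G).
Proof.
split=> [|x]; first exact: laplacian_sym.
rewrite -/(bform _ x x) -(pmulr_rge0 _ (ltr0n _ 2)) bform_laplacian.
by do 2![apply: sumr_ge0 => ? _]; apply/bform_ge0/mw_weight_psd.
Qed.

Lemma laplacian_ker x i j : mwLaplacian G *m x = 0 ->
  bform (mw_weight G i j) (blk x i - blk x j) (blk x i - blk x j) = 0.
Proof.
move=> Lx; have Lxx : bform (mwLaplacian G) x x = 0.
  by rewrite bform_mulr Lx /bform mulmx0 mxE.
have := bform_laplacian x; rewrite Lxx mulr0 => /esym/eqP.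
have w_ge0 k l :
    0 <= bform (mw_weight G k l) (blk x k - blk x l) (blk x k - blk x l).
  exact/bform_ge0/mw_weight_psd.
rewrite psumr_eq0 => [/allP/(_ i (mem_index_enum _))/=|k _]; last first.
  by apply: sumr_ge0 => l _; exact: w_ge0.
rewrite psumr_eq0 => [/allP/(_ j (mem_index_enum _))/=/eqP//|k _].
exact: w_ge0.
Qed.

(** The double sum of [A_ij (x_i - x_j)] changes sign when [i] and [j] are
    exchanged. *)
Lemma block_sum_laplacian x : block_sum_mx *m (mwLaplacian G *m x) = 0.
Proof.
rewrite block_sum_mxE; set S := \sum_i _.
have SN : S = - S.
  rewrite /S -sumrN; under eq_bigr do rewrite blk_laplacian.
  under [RHS]eq_bigr do rewrite blk_laplacian -sumrN.
  rewrite exchange_big; apply: eq_bigr => i _; apply: eq_bigr => j _ /=.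
  by rewrite mw_weight_sym -mulmxN opprB.
have /eqP : 2 *: S = 0 by rewrite scalerDl scale1r {1}SN addNr.
by rewrite scaler_eq0 pnatr_eq0 => /eqP.
Qed.

Lemma laplacian_consensus x : (forall i j, blk x i = blk x j) ->
  mwLaplacian G *m x = 0.
Proof.
move=> xE; apply: blk_inj => i; rewrite blk_laplacian blk0.
by rewrite big1 // => j _; rewrite (xE i j) subrr mulmx0.
Qed.

End Laplacian.

(** A vector killed by all the Laplacians gives the form of each summed weight
    [A_ij] the value 0 at [y_i - y_j]; on tree edges that weight is definite, so
    [y_i = y_j], and connectedness of the tree makes [y] a consensus vector. *)
Lemma union_kernel {R : realType} {n d : nat} (G : nat -> mwgraph R n d)
    (s e : nat) (T : rel 'I_n) (y : 'cV[R]_(n * d)) :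
  positive_spanning_tree (mwUnion G s e) T -> block_sum_mx *m y = 0 ->
  (forall k, (s <= k <= e)%N -> mwLaplacian (G k) *m y = 0) -> y = 0.
Proof.
move=> [[_ _ Tconn _] _ Tpd] Jy Ly.
have edge i j : T i j -> blk y i = blk y j.
  move=> /Tpd [_ pd]; apply/eqP; rewrite -subr_eq0; apply: contraT => /pd.
  rewrite /= /mwU_weight mulmx_sumr mulmx_suml summxE big_seq.
  rewrite big1 ?ltxx // => k.
  rewrite mem_index_iota ltnS => /Ly; exact: laplacian_ker.
have const i j : blk y i = blk y j.
  have cl : fingraph.closed T [pred k | blk y k == blk y i].
    by move=> k l /edge kl; rewrite !inE kl.
  by have := closed_connect cl (Tconn i j); rewrite !inE eqxx => /esym/eqP.
apply: blk_inj => i; rewrite blk0; apply/eqP.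
have : n%:R *: blk y i = 0.
  rewrite -Jy block_sum_mxE (eq_bigr (fun=> blk y i)) // sumr_const card_ord.
  by rewrite scaler_nat.
move/eqP; rewrite scaler_eq0 pnatr_eq0 => /orP[/eqP n0|//].
by have := ltn_ord i; rewrite [X in (_ < X)%N]n0.
Qed.

(** * The consensus theorem *)

(** Positivity of [alpha] forces the maximal norm [mu] to be positive, as [1 / 0 = 0],
    so the hypothesis does mean [alpha mu < 1]. *)
Lemma laplacian_step_bound {R : realType} {n d rho : nat}
    (G : 'I_rho -> mwgraph R n d) (sigma : nat -> 'I_rho) (alpha : R) :
  0 < alpha -> alpha < 1 / max_laplacian_norm G sigma ->
  forall k v, alpha * sqnorm (mwLaplacian (G (sigma k)) *m v)
    <= bform (mwLaplacian (G (sigma k))) v v.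
Proof.
move=> a0 amu k v; set L := mwLaplacian _.
set mu := max_laplacian_norm _ _ in amu.
have mu_gt0 : 0 < mu by have := lt_trans a0 amu; rewrite div1r invr_gt0.
have amu1 : alpha * mu <= 1 by rewrite -ler_pdivlMr // ltW.
have Lmu : spectral_norm L <= mu.
  apply: (le_bigmax_cond 0 (fun p => spectral_norm (mwLaplacian (G p)))).
  by apply/asboolP; exists k.
have Lv : sqnorm (L *m v) <= mu * bform L v v.
  apply: sqnorm_psd_mulmx_le; [exact: laplacian_psd | exact: ltW | move=> w].
  rewrite -!sqr_enorm -exprMn ler_sqr ?nnegrE ?mulr_ge0 ?enorm_ge0 //;
    last exact: ltW.
  by rewrite (le_trans (enorm_mulmx_le _ _)) // ler_wpM2r ?enorm_ge0.
have q0 : 0 <= bform L v v by apply/bform_ge0/laplacian_psd.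
rewrite (le_trans (ler_wpM2l (ltW a0) Lv)) // mulrA; exact: ler_piMl.
Qed.

Theorem theorem3 (R : realType) (n d rho : nat) (hn : (1 <= n)%N)
    (hd : (2 <= d)%N) (G : 'I_rho -> mwgraph R n d) (sigma : nat -> 'I_rho)
    (hsigma : piecewise_constant sigma) (hjoint : jointly_connected G sigma)
    (alpha : R) (alpha_gt0 : 0 < alpha)
    (alpha_lt : alpha < 1 / max_laplacian_norm G sigma)
    (x : nat -> 'cV[R]_(n * d))
    (hx : forall k : nat,
       x k.+1 = x k - alpha *: (mwLaplacian (G (sigma k)) *m x k)) :
  x k @[k --> \oo] --> average_consensus (x 0%N).
Proof.
have [kt [kt_mono kt_oo [B ktB] trees]] := hjoint.
have ktS t : (kt t < kt t.+1)%N by exact: kt_mono.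
set xs := average_consensus (x 0%N).
have xsE i j : blk xs i = blk xs j by rewrite !blk_average_consensus.
have sum_x k : block_sum_mx *m x k = block_sum_mx *m x 0%N.
  elim: k => // k IHk.
  by rewrite hx mulmxBr -scalemxAr block_sum_laplacian scaler0 subr0.
have sum_xs : block_sum_mx *m xs = block_sum_mx *m x 0%N.
  rewrite block_sum_mxE; under eq_bigr do rewrite blk_average_consensus.
  rewrite sumr_const card_ord -scaler_nat scalerA divff ?scale1r.
    by rewrite block_sum_mxE.
  by rewrite pnatr_eq0 -lt0n.
apply/subr_cvg0.
apply: (@switched_descent_cvg0 _ _ _ _ (fun p => mwLaplacian (G p)) block_sum_mx
  alpha sigma (fun k => x k - xs) _ alpha_gt0 _ _ kt B) => //.
- by move=> p; exact: laplacian_psd.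
- exact: laplacian_step_bound.
- move=> k; rewrite hx mulmxBr (laplacian_consensus _ xs xsE) subr0.
  by rewrite addrAC.
- by move=> k; rewrite mulmxBr sum_x sum_xs subrr.
move=> t y Jy Ly; have [T Ttree] := trees t.
apply: union_kernel Ttree Jy _ => k /andP[sk ke]; apply: Ly.
by rewrite sk -(ltn_predK (ktS t)) ltnS.
Qed.
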